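(* For integers $n, m \geq 1$ and a real normed space $X$ with $\dim(X) = n \leq 3$, \[ d_{BM}(X \oplus_1 \ell^m_1, \ell^{n+m}_1) = d_{BM}(X, \ell_1^n) \quad \text{and} \quad d_{BM}(X \oplus_{\infty} \ell^m_{\infty}, \ell^{n+m}_{\infty}) = d_{BM}(X, \ell_{\infty}^n). \]
   Context: $\ell_1^n$ and $\ell_\infty^n$ denote $\mathbb{R}^n$ with the norms $\|x\|_1 = \sum_i |x_i|$ and $\|x\|_\infty = \max_i |x_i|$. For normed spaces $X, Y$, the sum $X \oplus_1 Y$ is $X \times Y$ with norm $\|(x,y)\| = \|x\|_X + \|y\|_Y$, and $X \oplus_\infty Y$ is $X \times Y$ with norm $\|(x,y)\| = \max\{\|x\|_X, \|y\|_Y\}$. The Banach--Mazur distance between two real normed spaces $X, Y$ of the same finite dimension is $d_{BM}(X,Y) = \inf \|T\|\,\|T^{-1}\|$, the infimum over all invertible linear operators $T: X \to Y$, with operator norms. *)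

(* Defs.v *)
From HB Require Import structures.
From mathcomp Require Import all_boot all_order all_algebra.
From mathcomp Require Import all_classical all_reals all_analysis.
Set Implicit Arguments.
Unset Strict Implicit.
Unset Printing Implicit Defensive.
Set Warnings "-redundant-canonical-projection".
Import Order.TTheory GRing.Theory Num.Theory.
Import numFieldNormedType.Exports.
Local Open Scope classical_set_scope.
Local Open Scope ring_scope.

#[short(type="finNormedModType")]
HB.structure Definition FinNormedModule (R : numFieldType) :=
  {V of NormedModule R V & Vector R V}.

(* The library norms on ['rV[R]_n] and on [V * W] are the max norms, so these
   types are ell_infty^n and the infinity-sum; see [linf_normE] and
   [sumoo_normE]. *)
HB.instance Definition _ (R : numFieldType) (m n : nat) :=
  NormedModule.on 'M[R]_(m, n).

HB.instance Definition _ (R : numFieldType) (V W : finNormedModType R) :=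
  NormedModule.on (V * W)%type.

Definition linf (R : numFieldType) (n : nat) : finNormedModType R := 'rV[R]_n.

Definition sumoo (R : numFieldType) (V W : finNormedModType R) :
  finNormedModType R := (V * W)%type.

Lemma linf_normE (R : realType) n (x : linf R n) :
  `|x| = \big[Num.max/0]_(i < n) `|(x : 'rV[R]_n) 0 i|.
Proof.
rewrite [LHS]mx_normrE; apply/le_anti/andP; split; apply/bigmax_leP.
  by split=> [|[i j] _]; rewrite ?bigmax_ge_id//= ord1 le_bigmax.
by split=> [|j _]; rewrite ?bigmax_ge_id// (le_bigmax _ _ (0, j)).
Qed.

Lemma sumoo_normE (R : realType) (V W : finNormedModType R) (z : sumoo V W) :
  `|z| = Num.max `|z.1| `|z.2|.
Proof. by []. Qed.

(* ['rV[R]_n] and [V * W] already carry a norm, so the 1-norms are put on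
   aliases that retain only the vector space structure. *)
Definition l1_type (R : numFieldType) (n : nat) : Type := 'rV[R]_n.

Section L1.
Variables (R : numFieldType) (n : nat).

HB.instance Definition _ := Vector.copy (l1_type R n) 'rV[R]_n.

Definition l1_norm (x : l1_type R n) : R := \sum_(i < n) `|(x : 'rV[R]_n) 0 i|.

Let l1_normD x y : l1_norm (x + y) <= l1_norm x + l1_norm y.
Proof.
by rewrite /l1_norm -big_split ler_sum// => i _; rewrite mxE ler_normD.
Qed.

Let l1_normZ (a : R) x : l1_norm (a *: x) = `|a| * l1_norm x.
Proof.
by rewrite /l1_norm mulr_sumr; apply: eq_bigr => i _; rewrite mxE normrM.
Qed.

Let l1_norm0_eq0 x : l1_norm x = 0 -> x = 0.
Proof.
move=> /eqP; rewrite psumr_eq0// => /allP x0; apply/rowP => i.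
by rewrite mxE; apply/eqP; rewrite -normr_eq0 (implyP (x0 i _))// mem_index_enum.
Qed.

HB.instance Definition _ :=
  Lmodule_isNormed.Build R (l1_type R n) l1_normD l1_normZ l1_norm0_eq0.

Definition l1 : finNormedModType R := l1_type R n.

End L1.

Definition sum1_type (R : numFieldType) (V W : finNormedModType R) : Type :=
  (V * W)%type.

Section Sum1.
Variables (R : numFieldType) (V W : finNormedModType R).

HB.instance Definition _ := Vector.copy (sum1_type V W) (V * W)%type.

Definition sum1_norm (z : sum1_type V W) : R := `|z.1| + `|z.2|.

Let sum1_normD z t : sum1_norm (z + t) <= sum1_norm z + sum1_norm t.
Proof. by rewrite /sum1_norm addrACA lerD// ler_normD. Qed.

Let sum1_normZ (a : R) z : sum1_norm (a *: z) = `|a| * sum1_norm z.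
Proof. by rewrite /sum1_norm !normrZ mulrDr. Qed.

Let sum1_norm0_eq0 z : sum1_norm z = 0 -> z = 0.
Proof.
case: z => v w /eqP; rewrite paddr_eq0// !normr_eq0 => /andP[/eqP/= -> /eqP ->].
by [].
Qed.

HB.instance Definition _ :=
  Lmodule_isNormed.Build R (sum1_type V W) sum1_normD sum1_normZ sum1_norm0_eq0.

Definition sum1 : finNormedModType R := sum1_type V W.

End Sum1.

Lemma l1_normE (R : realType) n (x : l1 R n) :
  `|x| = \sum_(i < n) `|(x : 'rV[R]_n) 0 i|.
Proof. by []. Qed.

Lemma sum1_normE (R : realType) (V W : finNormedModType R) (z : sum1 V W) :
  `|z| = `|z.1| + `|z.2|.
Proof. by []. Qed.

Definition opnorm (R : realType) (V W : finNormedModType R)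
    (T : 'Hom(V, W)) : R :=
  sup [set `|T x| | x in [set x : V | `|x| <= 1]].

(* For bijective [T], the linear map [T^-1] is the two-sided inverse of [T]. *)
Definition dBM (R : realType) (V W : finNormedModType R) : R :=
  inf [set opnorm T * opnorm (T^-1)%VF | T in [set T : 'Hom(V, W) | bijective T]].

(* Main.v *)
(** For any finite-dimensional [V], an isomorphism of the 1-sum of [V] and a line
    [R u] with [l1^(N+1)] of distortion [c <= 3] yields one of [V] with [l1^N] of
    the same distortion. Indeed, let the [k]-th basis vector of [l1^(N+1)]
    correspond to [x_k + y_k u] with [||x_k|| + |y_k| <= 1], where [|y_k| >= 1/c]
    for a suitable [k]. Project onto [V] along [u + q], where [q] is
    [x_k / y_k] if [|y_k| >= 1/2] and [sgn(y_k) x_k / (1 - |y_k|)] otherwise. As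
    [||q|| <= 1] this projection has norm 1, and [c <= 3] ensures that the image
    of the [k]-th vector is a combination of the images of the others with
    coefficients of absolute sum at most 1, so that it may be dropped. The case of
    the infinity-sum is dual. Removing the [m] summands one by one shows that the
    distance on the left is at least [min(3, d(X, l1^n))], and Auerbach's lemma
    gives [d(X, l1^n) <= n <= 3]. *)
Require Import Defs.
From HB Require Import structures.
From mathcomp Require Import all_boot all_order all_algebra.
From mathcomp Require Import all_classical all_reals all_analysis.
From mathcomp Require Import perm ring lra.
Set Implicit Arguments.
Unset Strict Implicit.
Unset Printing Implicit Defensive.
Import Order.TTheory GRing.Theory Num.Theory.
Import numFieldNormedType.Exports.
Import VectorInternalTheory.
Local Open Scope classical_set_scope.
Local Open Scope ring_scope.

(** * Operator norms, and the Banach-Mazur distance through pairs of inverse maps *)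

Section OperatorNorm.
Variable R : realType.
Implicit Types V W : finNormedModType R.

Lemma linear_hom (K : fieldType) (V W : vectType K) (h : V -> W) :
  linear h -> exists T : 'Hom(V, W), T =1 h.
Proof.
move=> hlin; pose F : {linear V -> W} :=
  HB.pack h (GRing.isLinear.Build K V W _ h hlin).
by exists (linfun F) => x; rewrite lfunE.
Qed.

Lemma linear_row_sum (V : lmodType R) n (h : 'rV[R]_n -> V) (u : 'rV[R]_n) :
  linear h -> h u = \sum_j u 0 j *: h (delta_mx 0 j).
Proof.
move=> hlin; pose F : {linear 'rV[R]_n -> V} :=
  HB.pack h (GRing.isLinear.Build R 'rV[R]_n V _ h hlin).
rewrite [in LHS](row_sum_delta u).
apply: etrans (linear_sum F _ _ _) _; apply: eq_bigr => j _.
exact: (linearZ_LR F).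
Qed.

Lemma linear_rV_bounded V n (h : 'rV[R]_n -> V) : linear h ->
  exists2 K, 0 <= K & forall u, `|h u| <= K * `|u|.
Proof.
move=> hlin; exists (\sum_j `|h (delta_mx 0 j)|); first exact: sumr_ge0.
move=> u; rewrite (linear_row_sum _ hlin).
rewrite (le_trans (ler_norm_sum _ _ _))// mulr_suml ler_sum// => j _.
rewrite normrZ mulrC ler_wpM2l//.
by rewrite [`|u|]mx_normrE (le_bigmax _ _ (0, j)).
Qed.

(** On the compact unit sphere of coordinate space, the continuous function [|r2v u|] attains its
    minimum, which is positive because [r2v] is injective; [K] is its inverse. The sphere is empty
    in dimension 0. *)
Lemma v2r_bounded V : exists2 K, 0 <= K & forall v : V, `|v2r v| <= K * `|v|.
Proof.
have [K K0 leK] := @linear_rV_bounded V _ (@r2v R V) (@linearP _ _ _ _ (@r2v R V)).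
have r2v_cont : continuous (@r2v R V : 'rV[R]_(dim V) -> V).
  apply/linear_bounded_continuous/bounded_funP => r; exists (K * r) => x xr.
  by rewrite (le_trans (leK x))// ler_wpM2l.
pose S := [set u : 'rV[R]_(dim V) | `|u| = 1].
have [S_eq0|/set0P S0] := eqVneq S set0.
  exists 0 => // v; rewrite mul0r leNgt; apply/negP => v0.
  have : S (`|v2r v|^-1 *: v2r v).
    by rewrite /S /= normrZ normfV normr_id mulVf ?gt_eqF.
  by rewrite S_eq0.
have Scompact : compact S.
  apply: bounded_closed_compact.
    by exists 1; split=> // r r1 u /= ->; exact: ltW.
  apply: (@closed_comp _ _ (fun u : 'rV[R]_(dim V) => `|u|) [set 1]).
    by move=> u _; exact: norm_continuous.
  exact: closed_eq.
have [|u uS umin] := EVT_min_rV S0 Scompact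
    (f := fun u : 'rV[R]_(dim V) => `|r2v u : V|).
  apply: continuous_subspaceT => u.
  by apply: continuous_comp; [exact: r2v_cont | exact: norm_continuous].
have u_neq0 : u != 0.
  apply/eqP => u0; move: uS; rewrite u0 inE /S /= normr0 => /esym/eqP.
  by rewrite oner_eq0.
have r2vu_gt0 : 0 < `|r2v u : V|.
  rewrite normr_gt0; apply: contra_neq u_neq0 => u0.
  by apply: (@r2v_inj R V); rewrite u0 linear0.
exists `|r2v u : V|^-1 => [|v]; first by rewrite invr_ge0.
have [->|v0] := eqVneq v 0; first by rewrite linear0 !normr0 mulr0.
have v2rv_gt0 : 0 < `|v2r v|.
  rewrite normr_gt0; apply: contra_neq v0 => v0.
  by apply: (@v2r_inj R V); rewrite v0 linear0.
have /umin : `|v2r v|^-1 *: v2r v \in S.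
  by rewrite inE /S /= normrZ normfV normr_id mulVf ?gt_eqF.
rewrite linearZ /= v2rK normrZ normfV normr_id ler_pdivlMl// => le.
by rewrite ler_pdivlMl// mulrC.
Qed.

Lemma hom_bounded V W (T : 'Hom(V, W)) : exists K, forall x, `|T x| <= K * `|x|.
Proof.
have [K _ leK] := v2r_bounded V.
have [L L0 leL] := @linear_rV_bounded W _ (T \o r2v) (@linearP _ _ _ _ (T \o r2v)).
exists (L * K) => x; rewrite -mulrA -[x in leLHS]v2rK.
by rewrite (le_trans (leL _))// ler_wpM2l.
Qed.

Lemma opnorm_ubound V W (T : 'Hom(V, W)) :
  has_ubound [set `|T x| | x in [set x : V | `|x| <= 1]].
Proof.
have [K leK] := hom_bounded T.
exists `|K| => _ [y /= y1 <-]; rewrite (le_trans (leK y))//.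
by rewrite (le_trans (ler_wpM2r _ (ler_norm K)))// ler_piMr.
Qed.

Lemma opnorm_ge0 V W (T : 'Hom(V, W)) : 0 <= opnorm T.
Proof.
apply: ub_le_sup (opnorm_ubound T) _ _.
by exists 0 => /=; rewrite ?linear0 normr0.
Qed.

Lemma opnormP V W (T : 'Hom(V, W)) x : `|T x| <= opnorm T * `|x|.
Proof.
have [->|x0] := eqVneq x 0; first by rewrite linear0 !normr0 mulr0.
have nx : 0 < `|x| by rewrite normr_gt0.
rewrite -ler_pdivrMr// mulrC -[`|x|^-1]ger0_norm ?invr_ge0// -normrZ -linearZ.
apply: ub_le_sup (opnorm_ubound T) _ _.
by exists (`|x|^-1 *: x) => //=; rewrite normrZ normfV normr_id mulVf ?gt_eqF.
Qed.

Lemma opnorm_le V W (T : 'Hom(V, W)) a :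
  0 <= a -> (forall x, `|T x| <= a * `|x|) -> opnorm T <= a.
Proof.
move=> a0 leT; apply: ge_sup; first by exists `|T 0|, 0 => //=; rewrite normr0.
move=> _ [x /= x1 <-]; rewrite (le_trans (leT x))// -[leRHS]mulr1.
by rewrite ler_wpM2l.
Qed.

Lemma cancel_hom_dim (V W : vectType R) (f : 'Hom(V, W)) (g : 'Hom(W, V)) :
  \dim {:V} = \dim {:W} -> cancel f g -> cancel g f.
Proof.
move=> dVW fK y.
have kerf0 : lker f == 0%VS by apply/lker0P; exact: can_inj fK.
have /memv_imgP[x _ ->] : y \in limg f; last by rewrite fK.
suff -> : limg f = {:W}%VS by rewrite memvf.
have cap0 : ({:V} :&: lker f = 0)%VS by rewrite (eqP kerf0) capv0.
by apply/eqP; rewrite eqEdim subvf (limg_dim_eq cap0) dVW leqnn.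
Qed.

(* Only one composite is required to be the identity: when the dimensions agree
   the other one follows, see [cancel_hom_dim]. *)
Definition embeds V W a b := exists (f : 'Hom(V, W)) (g : 'Hom(W, V)),
  [/\ cancel f g, forall x, `|f x| <= a * `|x| & forall y, `|g y| <= b * `|y|].

Lemma dBM_le V W a b : 0 <= a -> 0 <= b -> \dim {:V} = \dim {:W} ->
  embeds V W a b -> dBM V W <= a * b.
Proof.
move=> a0 b0 dVW [f [g [fK lef leg]]].
have gK := cancel_hom_dim dVW fK.
have fVE : f^-1%VF =1 g.
  move=> y; rewrite -[y in LHS]gK; apply: lker0_lfunK.
  by apply/lker0P; exact: can_inj fK.
have opf : opnorm f * opnorm f^-1%VF <= a * b.
  apply: ler_pM; rewrite ?opnorm_ge0//; first exact: opnorm_le.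
  by apply: opnorm_le => // y; rewrite fVE.
apply: le_trans opf; apply: ge_inf.
  by exists 0 => _ [T _ <-]; rewrite mulr_ge0 ?opnorm_ge0.
by exists f => //; exists g.
Qed.

(** Take [T] of distortion below [a * b] and rescale it to norm [a]; the inverse then has norm below
    [b]. The embedding with constants [c] and [d] ensures that the infimum runs over a nonempty
    set. *)
Lemma dBM_embeds V W a b c d : \dim {:V} = \dim {:W} -> embeds V W c d ->
  0 < a -> 0 < b -> dBM V W < a * b -> embeds V W a b.
Proof.
move=> dVW [f0 [g0 [f0K _ _]]] a0 b0 dBMlt.
have [|_ [T [S TK SK] <-] Tlt] := inf_lt _ dBMlt.
  exists (opnorm f0 * opnorm f0^-1%VF); exists f0 => //=.
  by exists g0 => //; exact: cancel_hom_dim.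
have TVE : cancel T T^-1%VF.
  by apply: lker0_lfunK; apply/lker0P; exact: can_inj TK.
(* A map of norm 0 cannot be rescaled, but being injective it forces [V] to be trivial. *)
have [T0|] := eqVneq (opnorm T) 0.
  have V0 (x : V) : x = 0.
    apply: (can_inj TK); apply/eqP; rewrite linear0 -normr_le0.
    by rewrite (le_trans (opnormP T x))// T0 mul0r.
  exists T, T^-1%VF; split=> // [x|y].
    by rewrite (V0 x) linear0 !normr0 mulr0.
  by rewrite (V0 (T^-1%VF y)) normr0 mulr_ge0// ltW.
rewrite eq_le opnorm_ge0 andbT -ltNge => T0.
exists ((a / opnorm T) *: T), ((opnorm T / a) *: T^-1%VF).
split=> [x|x|y].
- rewrite !lfunE /= linearZ /= TVE scalerA mulrC.
  by rewrite mulrA divfK ?divff ?scale1r ?gt_eqF.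
- rewrite lfunE /= normrZ gtr0_norm ?divr_gt0// -mulrA ler_pM2l//.
  by rewrite ler_pdivrMl// opnormP.
- rewrite lfunE /= normrZ gtr0_norm ?divr_gt0//.
  apply: (@le_trans _ _ (opnorm T / a * (opnorm T^-1%VF * `|y|))).
    by rewrite ler_pM2l ?divr_gt0// opnormP.
  by rewrite mulrA ler_wpM2r// mulrAC ler_pdivrMr// [leRHS]mulrC ltW.
Qed.

Lemma dim_sum1 V W : \dim {:sum1 V W} = (\dim {:V} + \dim {:W})%N.
Proof. by rewrite !dimvf. Qed.

Lemma dim_l1 n : \dim {:l1 R n} = n.
Proof. by rewrite !dimvf /dim /= mul1n. Qed.

Lemma dim_linf n : \dim {:linf R n} = n.
Proof. by rewrite !dimvf /dim /= mul1n. Qed.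

Lemma dim_sumoo V W : \dim {:sumoo V W} = (\dim {:V} + \dim {:W})%N.
Proof. by rewrite !dimvf. Qed.

End OperatorNorm.

(** * Removal of one line summand together with one coordinate *)

Section Reduction.
Variable R : realType.
Implicit Types V E : finNormedModType R.

(* Here [k] satisfies [w k * y k > 0] and [c * `|y k| >= 1]; then [a] is [0] if
   [`|y k| >= 1/2] and [sgn (y k) * (1 - 2 * `|y k|)] otherwise. In the second
   case [`|a| * c <= c - 2 <= 1]: this is where [c <= 3] is needed. *)
Lemma pivotP N (y w : 'I_N.+1 -> R) c : c <= 3 ->
  \sum_i w i * y i = 1 -> \sum_i `|w i| <= c ->
  exists k a, [/\ y k + a != 0, 1 - `|y k| <= `|y k + a|, 0 <= a * w k &
    `|a| * (\sum_j `|w (lift k j)|) <= 1 + a * w k].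
Proof.
move=> c3 wy wc.
(* Otherwise [c * (w i * y i) < |w i|] wherever [w i != 0]; as the [w i * y i] add up to 1 and the
   [|w i|] to at most [c], all [w i] would vanish. *)
have [k wk0 wyk] : exists2 k, w k != 0 & `|w k| <= c * (w k * y k).
  apply: contrapT => nk.
  have lt_k k : w k != 0 -> c * (w k * y k) < `|w k|.
    by move=> wk; rewrite ltNge; apply/negP => le_k; apply: nk; exists k.
  have /eqP : \sum_i (`|w i| - c * (w i * y i)) = 0.
    apply: le_anti; rewrite sumr_ge0 ?andbT => [|i _]; last first.
      have [->|/lt_k/ltW] := eqVneq (w i) 0; last by rewrite subr_ge0.
      by rewrite normr0 mul0r mulr0 subr0.
    by rewrite sumrB -mulr_sumr wy mulr1 subr_le0.
  rewrite psumr_eq0 => [/allP w0|i _]; last first.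
    have [->|/lt_k/ltW] := eqVneq (w i) 0; last by rewrite subr_ge0.
    by rewrite normr0 mul0r mulr0 subr0.
  have : \sum_i w i * y i = 0.
    apply: big1 => i _; have := w0 i (mem_index_enum i).
    have [->|/lt_k] := eqVneq (w i) 0; first by rewrite mul0r.
    by rewrite -subr_gt0 => /gt_eqF ->.
  by rewrite wy => /eqP; rewrite oner_eq0.
have wykgt0 : 0 < w k * y k.
  have : 0 < `|w k| by rewrite normr_gt0.
  have : 0 <= \sum_i `|w i| by exact: sumr_ge0.
  nra.
have S0 : 0 <= \sum_j `|w (lift k j)| by exact: sumr_ge0.
move: wc; rewrite (bigD1_ord k)//= => wc; exists k.
have [y2|y2] := lerP (1 / 2) `|y k|.
  exists 0; rewrite !addr0 !mul0r normr0 mul0r; split; [|lra|by []|lra].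
  by rewrite -normr_gt0; lra.
have [yk|yk] := lerP 0 (y k).
  exists (1 - 2 * y k); rewrite ger0_norm// in y2 *.
  have wk : 0 < w k by nra.
  rewrite gtr0_norm// in wc wyk.
  have cy : 1 <= c * y k by nra.
  have -> : y k + (1 - 2 * y k) = 1 - y k by ring.
  have y1 : 0 < 1 - y k by lra.
  have y21 : 0 < 1 - 2 * y k by lra.
  rewrite !gtr0_norm ?gt_eqF//; split=> //; nra.
exists (- 1 - 2 * y k); rewrite ltr0_norm// in y2 *.
have wk : w k < 0 by nra.
rewrite ltr0_norm// in wc wyk.
have cy : c * y k <= -1 by nra.
have -> : y k + (- 1 - 2 * y k) = - (1 + y k) by ring.
have -> : - 1 - 2 * y k = - (1 + 2 * y k) by ring.
have y1 : 0 < 1 + y k by lra.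
have y21 : 0 < 1 + 2 * y k by lra.
rewrite !normrN !gtr0_norm ?oppr_eq0 ?gt_eqF//; split; [by []|lra|nra|nra].
Qed.

(** For real numbers the larger of [|a + b|] and [|a - b|] equals [|a| + |b|]. *)
Lemma normD_le_of_normB (a b c : R) :
  `|a + b| <= c -> `|a - b| <= c -> `|a| + `|b| <= c.
Proof.
rewrite !ler_norml => /andP[? ?] /andP[? ?].
by have [a0|a0] := ger0P a; have [b0|b0] := ger0P b; lra.
Qed.

Lemma norm_le_linf n (x : linf R n) a :
  0 <= a -> (forall i, `|(x : 'rV[R]_n) 0 i| <= a) -> `|x| <= a.
Proof. by move=> a0 lea; rewrite linf_normE; apply: bigmax_le. Qed.

Lemma linf_norm_ge n (x : linf R n) i : `|(x : 'rV[R]_n) 0 i| <= `|x|.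
Proof. by rewrite linf_normE (le_bigmax _ (fun i => `|(x : 'rV[R]_n) 0 i|)). Qed.

Section Step.
(** [E] stands for the sum of [V] and the line through [u]: [J] is the inclusion of [V], while [p]
    and [r] are the two components. *)
Variables (V E : finNormedModType R) (J : 'Hom(V, E)) (p : 'Hom(E, V)).
Variables (r : 'Hom(E, R^o)) (u : E).
Hypotheses (pJ : cancel J p) (rJ : forall v, r (J v) = 0).
Hypotheses (pu : p u = 0) (ru : r u = 1).

(* With [x k = (y k + a) *: q] one has [P u = - q] and
   [P (g (delta_mx 0 k)) = a *: q], so that [P (g (delta_mx 0 k))] is a
   combination of the other [P (g (delta_mx 0 i))] with coefficients [- s * w i]. *)
Lemma l1_step N c : (forall e, `|e| = `|p e| + `|r e|) ->
  c <= 3 -> embeds E (l1 R N.+1) c 1 -> embeds V (l1 R N) c 1.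
Proof.
move=> normE c3 [f [g [fK lef leg]]].
have gE (a : l1 R N.+1) : g a = \sum_i (a : 'rV[R]_N.+1) 0 i *: g (delta_mx 0 i).
  exact/linear_row_sum/linearP.
(* [u = g (f u)] is the combination of the [g (delta_mx 0 i)] with coefficients [w i]. Applying [r]
   gives the first hypothesis of [pivotP]; the bound on [f] at the unit vector [u] gives the
   second. *)
pose w i := (f u : 'rV[R]_N.+1) 0 i.
pose x i := p (g (delta_mx 0 i)); pose y i := r (g (delta_mx 0 i)).
have [|||k [a [ya0 yk ak al]]] := @pivotP N y w c => //.
- have : r (g (f u)) = 1 by rewrite fK.
  rewrite gE linear_sum /= => <-; apply: eq_bigr => i _.
  by rewrite linearZ.
- have := lef u; rewrite l1_normE; congr (_ <= _).
  by rewrite normE pu ru normr0 normr1 add0r mulr1.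
have aw0 : 1 + a * w k != 0 by rewrite gt_eqF// ltr_wpDr.
pose s := a / (1 + a * w k).
pose q := (y k + a)^-1 *: x k.
(* [|x k| + |y k|] is the norm of [g (delta_mx 0 k)], hence at most 1, so
   [|x k| <= 1 - |y k| <= |y k + a|]. *)
have q1 : `|q| <= 1.
  rewrite normrZ normfV ler_pdivrMl ?normr_gt0// mulr1 (le_trans _ yk)//.
  rewrite lerBrDr [leLHS](_ : _ = `|g (delta_mx 0 k)|) ?normE//.
  rewrite -normE (le_trans (leg _))// mul1r l1_normE (bigD1 k)//= big1 ?addr0.
    by rewrite mxE !eqxx normr1.
  by move=> i ik; rewrite mxE (negPf ik) andbF normr0.
have xk : x k = (y k + a) *: q by rewrite scalerA divff ?scale1r.
(* [P] is the projection onto [V] along [u + J q]. *)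
pose P e := p e - r e *: q.
have Plin : linear P.
  move=> t e1 e2; rewrite /P.
  have -> : r (t *: e1 + e2) = t * r e1 + r e2 :> R by rewrite linearP.
  by rewrite linearP scalerDl -scalerA scalerBr opprD addrACA.
have leP e : `|P e| <= `|e|.
  rewrite normE (le_trans (ler_normB _ _))// lerD2l normrZ.
  by rewrite ler_piMr.
pose ext (b : l1 R N) : l1 R N.+1 :=
  \row_i oapp (fun j => (b : 'rV[R]_N) 0 j) 0 (unlift k i).
have extlin : linear ext.
  move=> t b1 b2; apply/rowP => i; rewrite !mxE.
  by case: unliftP => [j _|_] /=; rewrite ?mxE ?mulr0 ?addr0.
(* Expanding [u] in [P u = - q], the terms with index other than [k] sum to [- (1 + a * w k) *: q];
   the factor [- s] turns this into [a *: q], the image of the [k]-th basis vector. *)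
pose con (b : l1 R N.+1) : l1 R N := \row_j
  ((b : 'rV[R]_N.+1) 0 (lift k j) - s * (b : 'rV[R]_N.+1) 0 k * w (lift k j)).
have conlin : linear con.
  by move=> t b1 b2; apply/rowP => i; rewrite !mxE; ring.
have [f' f'E] : exists F : 'Hom(V, l1 R N), F =1 con \o f \o J.
  by apply: linear_hom => t v1 v2 /=; rewrite !linearP conlin.
have [g' g'E] : exists F : 'Hom(l1 R N, V), F =1 P \o g \o ext.
  by apply: linear_hom => t v1 v2 /=; rewrite extlin linearP Plin.
exists f', g'; split.
- move=> v; rewrite f'E g'E /=; set b := f (J v).
  pose bk := (b : 'rV[R]_N.+1) 0 k.
  (* [ext (con b)] differs from [b] by multiples of [f u] and of the [k]-th basis vector, whose
     contributions under [P \o g] cancel. *)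
  have -> : ext (con b) = b - (s * bk) *: f u
      - (bk - s * bk * w k) *: (delta_mx 0 k : l1 R N.+1).
    apply/rowP => i; rewrite !mxE; case: unliftP => [j ->|->] /=.
      by rewrite mxE eq_sym (negPf (neq_lift _ _)) mulr0 subr0.
    by rewrite eqxx mulr1 /bk /w; ring.
  rewrite 2!(linearB g) 2!(linearZ_LR g) /= !fK /P.
  rewrite 2!(linearB p) 2!(linearZ_LR p) 2!(linearB r) 2!(linearZ_LR r) /=.
  rewrite pJ rJ pu ru.
  rewrite -/(x k) xk scaler0 subr0 scalerA -addrA -opprD -scalerDl.
  set t := bk - s * bk * w k.
  rewrite [X in _ - X *: _](_ : _ =
    t * (y k + a) + (0 - s * bk * 1 - t * y k) :> R)//.
  rewrite [X in _ - X *: _](_ : _ = 0) ?scale0r ?subr0//.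
  by rewrite /t /s; field.
- move=> v; rewrite f'E /= (le_trans (_ : _ <= `|f (J v)|))//; last first.
    by rewrite (le_trans (lef _))// normE pJ rJ normr0 addr0.
  rewrite !l1_normE [leRHS](bigD1_ord k)//=; set b := f (J v).
  pose bk := (b : 'rV[R]_N.+1) 0 k.
  apply: (@le_trans _ _ (\sum_j (`|(b : 'rV[R]_N.+1) 0 (lift k j)| +
      `|s| * `|bk| * `|w (lift k j)|))).
    by apply: ler_sum => j _; rewrite mxE (le_trans (ler_normB _ _))// !normrM.
  rewrite big_split /= [leRHS]addrC lerD2l -mulr_sumr mulrAC ler_piMl//.
  (* By the last clause of [pivotP], what [con] adds to the other coordinates is at most [|bk|], the
     term that is dropped. *)
  rewrite /s normrM normfV mulrAC ler_pdivrMr ?normr_gt0// mul1r.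
  by rewrite (ger0_norm (_ : 0 <= 1 + _)) ?addr_ge0.
- move=> b; rewrite g'E /= mul1r (le_trans (leP _))// (le_trans (leg _))// mul1r.
  rewrite !l1_normE [leLHS](bigD1_ord k)//= mxE unlift_none /= normr0 add0r.
  by apply: ler_sum => j _; rewrite mxE liftK.
Qed.

(* Dual construction: on the range of [f \o D] the [k]-th coordinate [a * q v] is
   the combination of the other ones with coefficients [- s * w i]. *)
Lemma linf_step N c : (forall e, `|e| = Num.max `|p e| `|r e|) ->
  c <= 3 -> embeds E (linf R N.+1) 1 c -> embeds V (linf R N) 1 c.
Proof.
move=> normE c3 [f [g [fK lef leg]]].
have gE (a : linf R N.+1) :
    g a = \sum_i (a : 'rV[R]_N.+1) 0 i *: g (delta_mx 0 i).
  exact/linear_row_sum/linearP.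
pose w i := r (g (delta_mx 0 i)) : R.
have rgE (a : linf R N.+1) : r (g a) = \sum_i w i * (a : 'rV[R]_N.+1) 0 i.
  rewrite gE linear_sum; apply: eq_bigr => i _.
  by rewrite linearZ mulrC.
pose y i := (f u : 'rV[R]_N.+1) 0 i.
have [|||k [a [ya0 yk ak al]]] := @pivotP N y w c => //.
- by rewrite -rgE fK.
(* The sign vector is where the functional [r \o g] takes the value [\sum_i |w i|]. *)
- pose sw : linf R N.+1 := \row_i Num.sg (w i).
  have sw1 : `|sw| <= 1.
    by apply: norm_le_linf => // i; rewrite mxE normr_sg lern1 leq_b1.
  have c0 : 0 <= c.
    have := leg (f u); have := lef u.
    rewrite fK normE pu ru normr0 normr1 max_r// mul1r.
    have := normr_ge0 (f u); nra.
  have -> : \sum_i `|w i| = r (g sw).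
    by rewrite rgE; apply: eq_bigr => i _; rewrite mxE mulrC -normrEsg.
  rewrite (le_trans (ler_norm _))// (le_trans (_ : _ <= `|g sw|))//.
    by rewrite normE le_max lexx orbT.
  by rewrite (le_trans (leg _))// ler_piMr.
have aw0 : 1 + a * w k != 0 by rewrite gt_eqF// ltr_wpDr.
have aw1 : 0 < 1 + a * w k by rewrite ltr_wpDr.
pose s := a / (1 + a * w k).
pose q v := (y k + a)^-1 * (f (J v) : 'rV[R]_N.+1) 0 k.
(* Both [J v + |v| *: u] and [J v - |v| *: u] have norm [|v|]. Comparing the [k]-th coordinates of
   their images bounds that of [f (J v)] by [(1 - |y k|) * |v|]. *)
have q1 v : `|q v| <= `|v|.
  rewrite normrM normfV ler_pdivrMl ?normr_gt0//.
  apply: le_trans (ler_wpM2r (normr_ge0 v) yk).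
  have le_t t : `|t| = `|v| ->
      `|(f (J v) : 'rV[R]_N.+1) 0 k + t * y k| <= `|v|.
    move=> tv; have -> : (f (J v) : 'rV[R]_N.+1) 0 k + t * y k =
        (f (J v + t *: u) : 'rV[R]_N.+1) 0 k by rewrite linearD linearZ !mxE.
    rewrite (le_trans (linf_norm_ge _ _))// (le_trans (lef _))// mul1r normE.
    rewrite !linearD !linearZ /= pJ rJ pu ru scaler0 addr0 add0r.
    by rewrite [_ *: 1]mulr1 tv maxxx.
  rewrite mulrBl mul1r lerBrDr -[`|v| in leLHS]normr_id -normrM mulrC.
  apply: normD_le_of_normB; first by rewrite le_t ?normr_id.
  by rewrite -mulNr le_t// normrN normr_id.
(* [D] lifts [V] to the graph of [- q] in [E]; in the max norm this costs nothing, as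
   [|q v| <= |v|]. *)
pose D v := J v - q v *: u.
have Dlin : linear D.
  move=> t v1 v2; rewrite /D linearP scalerBr addrACA -opprD scalerA -scalerDl.
  by congr (_ - _ *: _); rewrite /q !linearP !mxE; ring.
have leD v : `|D v| <= `|v|.
  rewrite normE /D (linearB p) (linearB r) (linearZ_LR p) (linearZ_LR r) /=.
  rewrite pJ rJ pu ru scaler0 subr0 sub0r.
  by rewrite ge_max lexx /= normrN [_ *: 1]mulr1.
pose ext (b : linf R N) : linf R N.+1 :=
  \row_i oapp (fun j => (b : 'rV[R]_N) 0 j)
    (- s * \sum_j w (lift k j) * (b : 'rV[R]_N) 0 j) (unlift k i).
have extlin : linear ext.
  move=> t b1 b2; apply/rowP => i; rewrite !mxE.
  case: unliftP => [j _|_] /=; rewrite ?mxE// mulrCA -mulrDr.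
  congr (_ * _); rewrite mulr_sumr -big_split.
  by apply: eq_bigr => j _; rewrite !mxE /=; ring.
pose drop (b : linf R N.+1) : linf R N :=
  \row_j (b : 'rV[R]_N.+1) 0 (lift k j).
have droplin : linear drop by move=> t b1 b2; apply/rowP => i; rewrite !mxE.
have [f' f'E] : exists F : 'Hom(V, linf R N), F =1 drop \o f \o D.
  by apply: linear_hom => t v1 v2 /=; rewrite Dlin linearP droplin.
have [g' g'E] : exists F : 'Hom(linf R N, V), F =1 p \o g \o ext.
  by apply: linear_hom => t v1 v2 /=; rewrite extlin !linearP.
exists f', g'; split.
- move=> v; rewrite f'E g'E /=; set b := f (D v).
  suff -> : ext (drop b) = b.
    by rewrite fK /D (linearB p) (linearZ_LR p) /= pJ pu scaler0 subr0.
  have bk : (b : 'rV[R]_N.+1) 0 k = a * q v.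
    rewrite /b /D (linearB f) (linearZ_LR f) !mxE -/(y k).
    suff -> : (f (J v) : 'rV[R]_N.+1) 0 k = (y k + a) * q v by ring.
    by rewrite /q mulrA divff ?mul1r.
  (* Expanding [r (g b)], the terms other than the [k]-th add up to [- (1 + a * w k) * q v];
     multiplied by [- s] this is [a * q v], so [ext] restores the dropped coordinate. *)
  have : r (g b) = - q v.
    by rewrite fK /D (linearB r) (linearZ_LR r) /= rJ ru sub0r [_ *: 1]mulr1.
  rewrite rgE (bigD1_ord k)//= bk => rb.
  apply/rowP => i; rewrite mxE; case: unliftP => [j ->|->] /=; first by rewrite mxE.
  rewrite bk; under eq_bigr do rewrite mxE.
  have -> : \sum_(j < N) w (lift k j) * (b : 'rV[R]_N.+1) 0 (lift k j) =
    - q v - w k * (a * q v) by rewrite -rb; ring.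
  by rewrite /s; field.
- move=> v; rewrite f'E /= mul1r (le_trans _ (leD v))//.
  rewrite (le_trans (_ : _ <= `|f (D v)|))//; last first.
    by rewrite (le_trans (lef _)) ?mul1r.
  by apply: norm_le_linf => // j; rewrite mxE linf_norm_ge.
- move=> b; rewrite g'E /= (le_trans (_ : _ <= `|g (ext b)|))//.
    by rewrite normE le_max lexx.
  have c0 : 0 <= c.
    have := leg (f u); have := lef u.
    rewrite fK normE pu ru normr0 normr1 max_r// mul1r.
    have := normr_ge0 (f u); nra.
  rewrite (le_trans (leg _))// ler_wpM2l//; apply: norm_le_linf => // i.
  rewrite mxE; case: unliftP => [j _|_] /=; first exact: linf_norm_ge.
  rewrite normrM normrN /s normrM normfV (gtr0_norm aw1).
  rewrite mulrAC ler_pdivrMr//.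
  apply: (@le_trans _ _ (`|a| * ((\sum_j `|w (lift k j)|) * `|b|))).
    rewrite ler_wpM2l// (le_trans (ler_norm_sum _ _ _))// mulr_suml.
    by apply: ler_sum => j _; rewrite normrM ler_wpM2l// linf_norm_ge.
  by rewrite mulrA [leRHS]mulrC ler_wpM2r.
Qed.
End Step.
End Reduction.

(** * Auerbach's lemma up to a factor [t > 1] *)

Section Auerbach.
Variables (R : realType) (V : finNormedModType R).
Local Notation n := (dim V).

Let coord_mx (e : 'I_n -> V) : 'M[R]_n := \matrix_i v2r (e i).
Let unit_family := [set e : 'I_n -> V | forall i, `|e i| <= 1].
Let dets := [set `|\det (coord_mx e)| | e in unit_family].

(** In the Leibniz formula each term is a product of [n] entries of size at most [K]. *)
Let dets_ubound : has_ubound dets.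
Proof.
have [K K0 leK] := v2r_bounded V.
exists (\sum_(s : 'S_(dim V)) K ^+ n) => _ [e e1 <-].
rewrite /determinant (le_trans (ler_norm_sum _ _ _))// ler_sum// => s _.
rewrite normrM normr_sign mul1r normr_prod.
rewrite -[leRHS](_ : \prod_(i < n) K = _); last first.
  by rewrite prodr_const card_ord.
apply: ler_prod => i _; rewrite normr_ge0 mxE /=.
apply: (@le_trans _ _ `|v2r (e i)|).
  by rewrite [`|v2r _|]mx_normrE (le_bigmax _ _ (0, s i)).
by rewrite (le_trans (leK _))// ler_piMr.
Qed.

(** The normalised coordinate basis has a diagonal matrix with nonzero entries. *)
Let sup_dets_gt0 : 0 < sup dets.
Proof.
pose b i : V := r2v (delta_mx 0 i).
have b0 i : `|b i| != 0.
  rewrite normr_eq0; apply/eqP => bi0.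
  have /rowP /(_ i) : delta_mx 0 i = 0 :> 'rV[R]_n.
    by apply: (@r2v_inj R V); rewrite [LHS]bi0 linear0.
  by rewrite !mxE !eqxx => /eqP; rewrite oner_eq0.
pose e i : V := `|b i|^-1 *: b i.
have eE : coord_mx e = diag_mx (\row_i `|b i|^-1).
  apply/matrixP => i j; rewrite !mxE linearZ /= r2vK !mxE eqxx /= eq_sym.
  by case: eqP => [->|]; rewrite ?mulr1 ?mulr0.
apply: (@lt_le_trans _ _ `|\det (coord_mx e)|).
  rewrite normr_gt0 eE det_diag; apply/prodf_neq0 => i _.
  by rewrite mxE invr_neq0.
apply: ub_le_sup => //; exists e => // i.
by rewrite normrZ normfV normr_id mulVf.
Qed.

(* Take [e] with determinant within a factor [t] of the supremum, and estimate the
   coordinates with Cramer's rule. *)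
Lemma almost_auerbach t : 1 < t ->
  exists (e : 'I_n -> V) (phi : V -> 'rV[R]_n), [/\ linear phi,
    forall i, `|e i| <= 1, forall x, x = \sum_i phi x 0 i *: e i &
    forall x i, `|phi x 0 i| <= t * `|x|].
Proof.
move=> t1; have t0 : 0 < t by exact: lt_trans t1.
have dets0 : dets !=set0.
  by exists `|\det (coord_mx (fun=> 0))|, (fun=> 0) => // i; rewrite normr0.
have [|_ [e e1 <-] dete] := @sup_gt _ dets (sup dets / t) dets0.
  by rewrite ltr_pdivrMr// ltr_pMr.
set d := \det (coord_mx e) in dete.
have d0 : 0 < `|d| by apply: le_lt_trans dete; rewrite divr_ge0 ?ltW.
have eU : coord_mx e \in unitmx by rewrite unitmxE unitfE -normr_gt0.
pose phi x : 'rV[R]_n := v2r x *m invmx (coord_mx e).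
have philin : linear phi.
  by move=> a x y; rewrite /phi linearP mulmxDl -scalemxAl.
have phi1 x i : `|x| <= 1 -> `|phi x 0 i| <= t.
  move=> x1; pose e' j := if j == i then x else e j.
  have phiE : phi x 0 i * d = \det (coord_mx e').
    rewrite /phi /invmx eU -scalemxAr mxE mulrAC mulVf ?mul1r -?normr_gt0//.
    rewrite (expand_det_row _ i) mxE; apply: eq_bigr => j _.
    rewrite !mxE /e' eqxx; congr (_ * (_ * \det _)); apply/matrixP => k l.
    by rewrite !mxE eq_sym (negPf (neq_lift _ _)).
  rewrite -(ler_pM2r d0) -normrM phiE.
  (* [e'] is again a family in the unit ball, so its determinant is at most [sup dets], which is
     below [t * |d|] by the choice of [e]. *)
  apply: (@le_trans _ _ (sup dets)); last by rewrite -ler_pdivrMl// mulrC ltW.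
  apply: ub_le_sup => //; exists e' => // j.
  by rewrite /e'; case: eqP.
exists e, phi; split=> // [x|x i].
  apply: (@v2r_inj R V); rewrite linear_sum /=.
  rewrite -[LHS](mulmxKV eU) mulmx_sum_row; apply: eq_bigr => i _.
  by rewrite linearZ rowK.
have [->|x0] := eqVneq x 0.
  by rewrite /phi linear0 mul0mx mxE !normr0 mulr0.
have nx : 0 < `|x| by rewrite normr_gt0.
rewrite -ler_pdivrMr// mulrC -[`|x|^-1]ger0_norm ?invr_ge0// -normrM.
have -> : `|x|^-1 * phi x 0 i = phi (`|x|^-1 *: x) 0 i.
  by rewrite /phi linearZ -scalemxAl [RHS]mxE.
by apply: phi1; rewrite normrZ normfV normr_id mulVf ?gt_eqF.
Qed.

(** Each coordinate is at most [t * |x|], and there are [n] of them; the inverse is contractive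
    since the [e i] lie in the unit ball. In [embeds_linf] the factor [n] falls on the inverse
    instead. *)
Lemma embeds_l1 t : 1 < t -> embeds V (l1 R n) (n%:R * t) 1.
Proof.
move=> t1; have [e [phi [philin e1 eE phit]]] := almost_auerbach t1.
have [f fE] : exists F : 'Hom(V, l1 R n), F =1 phi by exact: linear_hom.
have [g gE] : exists F : 'Hom(l1 R n, V),
    F =1 fun a : l1 R n => \sum_i (a : 'rV[R]_n) 0 i *: e i.
  apply: linear_hom => a x y; rewrite scaler_sumr -big_split.
  by apply: eq_bigr => i _; rewrite !mxE scalerDl scalerA.
exists f, g; split=> [x|x|a].
- by rewrite fE gE -eE.
- rewrite l1_normE fE -mulrA mulr_natl -[n in _ *+ n]card_ord -sumr_const.
  by rewrite ler_sum.
- rewrite gE mul1r l1_normE (le_trans (ler_norm_sum _ _ _))// ler_sum// => i _.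
  by rewrite normrZ ler_piMr.
Qed.

Lemma embeds_linf t : 1 < t -> embeds V (linf R n) t n%:R.
Proof.
move=> t1; have [e [phi [philin e1 eE phit]]] := almost_auerbach t1.
have t0 : 0 <= t by rewrite ltW// (lt_trans _ t1).
have [f fE] : exists F : 'Hom(V, linf R n), F =1 phi by exact: linear_hom.
have [g gE] : exists F : 'Hom(linf R n, V),
    F =1 fun a : linf R n => \sum_i (a : 'rV[R]_n) 0 i *: e i.
  apply: linear_hom => a x y; rewrite scaler_sumr -big_split.
  by apply: eq_bigr => i _; rewrite !mxE scalerDl scalerA.
exists f, g; split=> [x|x|a].
- by rewrite fE gE -eE.
- by apply: norm_le_linf => [|i]; rewrite ?mulr_ge0// fE.
- rewrite gE mulr_natl -[n in _ *+ n]card_ord -sumr_const.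
  rewrite (le_trans (ler_norm_sum _ _ _))// ler_sum// => i _.
  rewrite normrZ (le_trans (ler_wpM2l _ (e1 i)))// mulr1.
  exact: linf_norm_ge.
Qed.

End Auerbach.

(** * Adding and removing [m] coordinates *)

Section Sums.
Variable R : realType.
Implicit Types X V W : finNormedModType R.

Lemma dBM_ge0 V W : 0 <= dBM V W.
Proof.
rewrite /dBM; set S := (X in inf X).
have [->|/set0P S0] := eqVneq S set0; first by rewrite inf0.
by apply: lb_le_inf => // _ [T _ <-]; rewrite mulr_ge0 ?opnorm_ge0.
Qed.

Lemma embeds_ge1 V W a b :
  (0 < \dim {:V})%N -> 0 <= b -> embeds V W a b -> 1 <= a * b.
Proof.
move=> dV b0 [f [g [fK lef leg]]].
have [x x0] : exists x : V, x != 0.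
  exists (vpick {:V}); rewrite vpick0; apply/eqP => V0.
  by move: dV; rewrite V0 dimv0.
have nx : 0 < `|x| by rewrite normr_gt0.
rewrite -(ler_pM2r nx) mul1r -[in leLHS](fK x) (le_trans (leg _))//.
by rewrite (le_trans (ler_wpM2l b0 (lef x)))// mulrCA mulrA.
Qed.

(** The given maps are extended by the identity on the second summand, which obeys the bound [c]
    because [1 <= c]. *)
Lemma sum1_embeds X n m c : 1 <= c -> embeds X (l1 R n) c 1 ->
  embeds (sum1 X (l1 R m)) (l1 R (n + m)) c 1.
Proof.
move=> c1 [f [g [fK lef leg]]].
have [F FE] : exists F : 'Hom(sum1 X (l1 R m), l1 R (n + m)),
    F =1 fun z : sum1 X (l1 R m) => row_mx (f z.1 : 'rV[R]_n) z.2.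
  apply: linear_hom => a x y /=.
  by rewrite linearP -add_row_mx -scale_row_mx.
have [G GE] : exists G : 'Hom(l1 R (n + m), sum1 X (l1 R m)),
    G =1 fun b : l1 R (n + m) => (g (lsubmx b), rsubmx b).
  by apply: linear_hom => a x y /=; rewrite !linearP.
exists F, G; split=> [[x b]|[x b]|b].
- by rewrite FE GE /= row_mxKl row_mxKr fK.
- rewrite FE l1_normE big_split_ord sum1_normE /= mulrDr; apply: lerD.
    rewrite (le_trans _ (lef x))// l1_normE; apply: ler_sum => i _.
    by rewrite row_mxEl.
  apply: le_trans (_ : `|b| <= _); last by rewrite ler_peMl.
  by rewrite l1_normE; apply: ler_sum => i _; rewrite row_mxEr.
- rewrite GE mul1r sum1_normE [leRHS]l1_normE big_split_ord /=; apply: lerD.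
    rewrite (le_trans (leg _))// mul1r l1_normE; apply: ler_sum => i _.
    by rewrite mxE.
  by rewrite l1_normE; apply: ler_sum => i _; rewrite mxE.
Qed.

Lemma sumoo_embeds X n m c : 1 <= c -> embeds X (linf R n) 1 c ->
  embeds (sumoo X (linf R m)) (linf R (n + m)) 1 c.
Proof.
move=> c1 [f [g [fK lef leg]]]; have c0 : 0 <= c by exact: le_trans c1.
have [F FE] : exists F : 'Hom(sumoo X (linf R m), linf R (n + m)),
    F =1 fun z : sumoo X (linf R m) => row_mx (f z.1 : 'rV[R]_n) z.2.
  apply: linear_hom => a x y /=.
  by rewrite linearP -add_row_mx -scale_row_mx.
have [G GE] : exists G : 'Hom(linf R (n + m), sumoo X (linf R m)),
    G =1 fun b : linf R (n + m) => (g (lsubmx b), rsubmx b).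
  by apply: linear_hom => a x y /=; rewrite !linearP.
exists F, G; split=> [[x b]|[x b]|b].
- by rewrite FE GE /= row_mxKl row_mxKr fK.
- rewrite FE mul1r sumoo_normE /=; apply: norm_le_linf => [|i].
    by rewrite le_max normr_ge0.
  rewrite le_max; case: (split_ordP i) => j ->.
    rewrite row_mxEl (le_trans (linf_norm_ge (f x) j))//.
    by rewrite (le_trans (lef x)) ?mul1r.
  by rewrite row_mxEr (linf_norm_ge b j) orbT.
- rewrite GE sumoo_normE ge_max /= (le_trans (leg _)) /=.
    apply: le_trans (_ : `|b| <= _); last by rewrite ler_peMl.
    by apply: norm_le_linf => // i; rewrite mxE; exact: linf_norm_ge.
  rewrite ler_wpM2l//.
  by apply: norm_le_linf => // i; rewrite mxE; exact: linf_norm_ge.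
Qed.

(** Induction on [m]: [l1_step] removes the line spanned by the first basis vector of the second
    summand, lowering the target dimension by one as well. At [m = 0] that summand is trivial. *)
Lemma sum1_embeds_inv X n m c : c <= 3 ->
  embeds (sum1 X (l1 R m)) (l1 R (n + m)) c 1 -> embeds X (l1 R n) c 1.
Proof.
move=> c3; elim: m => [|m IH]; rewrite ?addn0 ?addnS.
  move=> [f [g [fK lef leg]]].
  have [F FE] : exists F : 'Hom(X, l1 R n), F =1 fun x => f (x, 0).
    apply: linear_hom => a x y; rewrite -linearP; congr (f _).
    by apply: injective_projections; rewrite /= ?scaler0 ?addr0.
  have [G GE] : exists G : 'Hom(l1 R n, X), G =1 fun b => (g b).1.
    by apply: linear_hom => a x y; rewrite linearP.
  exists F, G; split=> [x|x|b].
  - by rewrite FE GE fK.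
  - by rewrite FE (le_trans (lef _))// sum1_normE normr0 addr0.
  - by rewrite GE (le_trans _ (leg b))// sum1_normE lerDl.
move=> emb; apply: IH.
pose E := sum1 X (l1 R m.+1); pose V := sum1 X (l1 R m).
have [J JE] : exists J : 'Hom(V, E), J =1 fun z => (z.1,
    (\row_i oapp (fun j => (z.2 : 'rV[R]_m) 0 j) 0 (unlift ord0 i) : l1 R m.+1)).
  apply: linear_hom => a x y; apply: injective_projections => //=.
  apply/rowP => i; rewrite !mxE.
  by case: unliftP => [j _|_] /=; rewrite ?mxE ?mulr0 ?addr0.
have [p pE] : exists p : 'Hom(E, V), p =1 fun z => (z.1,
    (\row_j (z.2 : 'rV[R]_m.+1) 0 (lift ord0 j) : l1 R m)).
  apply: linear_hom => a x y; apply: injective_projections => //=.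
  by apply/rowP => i; rewrite !mxE.
have [r rE] : exists r : 'Hom(E, R^o), r =1 fun z => (z.2 : 'rV[R]_m.+1) 0 ord0.
  by apply: linear_hom => a x y; rewrite !mxE.
apply: (@l1_step R V E J p r (0, (delta_mx 0 ord0 : l1 R m.+1))) emb => //.
- move=> [x b]; rewrite pE JE; congr pair; apply/rowP => i.
  by rewrite !mxE liftK.
- by move=> [x b]; rewrite rE JE mxE unlift_none.
- by rewrite pE; congr pair; apply/rowP => i; rewrite !mxE.
- by rewrite rE mxE !eqxx.
- move=> [x b]; rewrite pE rE !sum1_normE /= !l1_normE big_ord_recl.
  rewrite -addrA [X in _ = _ + X]addrC.
  by congr (_ + (_ + _)); apply: eq_bigr => j _; rewrite mxE.
Qed.

Lemma sumoo_embeds_inv X n m c : c <= 3 ->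
  embeds (sumoo X (linf R m)) (linf R (n + m)) 1 c -> embeds X (linf R n) 1 c.
Proof.
move=> c3; elim: m => [|m IH]; rewrite ?addn0 ?addnS.
  move=> [f [g [fK lef leg]]].
  have [F FE] : exists F : 'Hom(X, linf R n), F =1 fun x => f (x, 0).
    apply: linear_hom => a x y; rewrite -linearP; congr (f _).
    by apply: injective_projections; rewrite /= ?scaler0 ?addr0.
  have [G GE] : exists G : 'Hom(linf R n, X), G =1 fun b => (g b).1.
    by apply: linear_hom => a x y; rewrite linearP.
  exists F, G; split=> [x|x|b].
  - by rewrite FE GE fK.
  - by rewrite FE (le_trans (lef _))// sumoo_normE normr0 max_l.
  - by rewrite GE (le_trans _ (leg b))// sumoo_normE le_max lexx.
move=> emb; apply: IH.
pose E := sumoo X (linf R m.+1); pose V := sumoo X (linf R m).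
have [J JE] : exists J : 'Hom(V, E), J =1 fun z => (z.1,
    (\row_i oapp (fun j => (z.2 : 'rV[R]_m) 0 j) 0 (unlift ord0 i) : linf R m.+1)).
  apply: linear_hom => a x y; apply: injective_projections => //=.
  apply/rowP => i; rewrite !mxE.
  by case: unliftP => [j _|_] /=; rewrite ?mxE ?mulr0 ?addr0.
have [p pE] : exists p : 'Hom(E, V), p =1 fun z => (z.1,
    (\row_j (z.2 : 'rV[R]_m.+1) 0 (lift ord0 j) : linf R m)).
  apply: linear_hom => a x y; apply: injective_projections => //=.
  by apply/rowP => i; rewrite !mxE.
have [r rE] : exists r : 'Hom(E, R^o), r =1 fun z => (z.2 : 'rV[R]_m.+1) 0 ord0.
  by apply: linear_hom => a x y; rewrite !mxE.
apply: (@linf_step R V E J p r (0, (delta_mx 0 ord0 : linf R m.+1))) emb => //.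
- move=> [x b]; rewrite pE JE; congr pair; apply/rowP => i.
  by rewrite !mxE liftK.
- by move=> [x b]; rewrite rE JE mxE unlift_none.
- by rewrite pE; congr pair; apply/rowP => i; rewrite !mxE.
- by rewrite rE mxE !eqxx.
- move=> [x b]; rewrite pE rE !sumoo_normE /= !linf_normE big_ord_recl.
  rewrite -maxA [X in _ = Num.max _ X]maxC.
  by congr (Num.max _ (Num.max _ _)); apply: eq_bigr => j _; rewrite mxE.
Qed.

End Sums.

(** * The two equalities of distances *)

Section Main.
Variables (R : realType) (X : finNormedModType R).

Lemma dBM_sum1 n m : (0 < n)%N -> \dim {:X} = n -> (n <= 3)%N ->
  dBM (sum1 X (l1 R m)) (l1 R (n + m)) = dBM X (l1 R n).
Proof.
move=> n0 dX n3; have dXn : \dim {:X} = \dim {:l1 R n} by rewrite dim_l1.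
have dE : \dim {:sum1 X (l1 R m)} = \dim {:l1 R (n + m)}.
  by rewrite dim_sum1 dX !dim_l1.
have embX t : 1 < t -> embeds X (l1 R n) (n%:R * t) 1.
  by rewrite -dX dimvf; exact: embeds_l1.
have embE t : 1 < t ->
    embeds (sum1 X (l1 R m)) (l1 R (n + m)) ((n + m)%:R * t) 1.
  by rewrite -(dim_l1 R (n + m)) -dE dimvf; exact: embeds_l1.
have le3 : dBM X (l1 R n) <= 3.
  apply/ler_addgt0Pr => e e0.
  (* With this factor Auerbach's bound [n * t] is at most [3 + e]. *)
  have t1 : 1 < 1 + e / 3 by rewrite ltrDl divr_gt0.
  have t0 : 0 < 1 + e / 3 by exact: lt_trans t1.
  have t0' := mulr_ge0 (ler0n R n) (ltW t0).
  apply: le_trans (dBM_le t0' ler01 dXn (embX _ t1)) _.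
  have -> : 3 + e = 3 * (1 + e / 3) by field.
  by rewrite mulr1 ler_wpM2r ?ler_nat// ltW.
apply/le_anti/andP; split.
  apply/ler_addgt0Pr => e e0.
  have b0 : 0 < dBM X (l1 R n) + e by rewrite ltr_wpDl ?dBM_ge0.
  have emb : embeds X (l1 R n) (dBM X (l1 R n) + e) 1.
    (* The value 2 is arbitrary: some isomorphism with [l1 R n] has to exist. *)
    apply: dBM_embeds dXn (embX 2 _) _ _ _; rewrite ?ltr1n//.
    by rewrite mulr1 ltrDl.
  rewrite -[leRHS]mulr1; apply: dBM_le => //; first exact: ltW.
  apply: sum1_embeds (emb); rewrite -[leRHS]mulr1.
  by apply: embeds_ge1 emb => //; rewrite dX.
rewrite leNgt; apply/negP => lt.
(* The midpoint exceeds the distance of the sum, so it is attained as a distortion, and is below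
   [dBM X (l1 R n) <= 3], so the summands can be removed; hence the contradiction
   [dBM X (l1 R n) <= c]. *)
pose c := (dBM (sum1 X (l1 R m)) (l1 R (n + m)) + dBM X (l1 R n)) / 2.
have Ec : dBM (sum1 X (l1 R m)) (l1 R (n + m)) < c by rewrite /c; lra.
have cX : c < dBM X (l1 R n) by rewrite /c; lra.
have c0 : 0 < c by exact: le_lt_trans (dBM_ge0 _ _) Ec.
suff : dBM X (l1 R n) <= c by rewrite leNgt cX.
rewrite -[leRHS]mulr1; apply: dBM_le => //; first exact: ltW.
apply: (@sum1_embeds_inv _ _ _ m); first by rewrite ltW// (lt_le_trans cX).
by apply: dBM_embeds dE (embE 2 _) _ _ _; rewrite ?ltr1n// mulr1.
Qed.

(** Here the forward map is contractive and the inverse carries the distortion, the normalisation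
    that [linf_step] requires. *)
Lemma dBM_sumoo n m : (0 < n)%N -> \dim {:X} = n -> (n <= 3)%N ->
  dBM (sumoo X (linf R m)) (linf R (n + m)) = dBM X (linf R n).
Proof.
move=> n0 dX n3; have dXn : \dim {:X} = \dim {:linf R n} by rewrite dim_linf.
have dE : \dim {:sumoo X (linf R m)} = \dim {:linf R (n + m)}.
  by rewrite dim_sumoo dX !dim_linf.
have embX t : 1 < t -> embeds X (linf R n) t n%:R.
  by rewrite -dX dimvf; exact: embeds_linf.
have embE t : 1 < t ->
    embeds (sumoo X (linf R m)) (linf R (n + m)) t (n + m)%:R.
  by rewrite -(dim_linf R (n + m)) -dE dimvf; exact: embeds_linf.
have le3 : dBM X (linf R n) <= 3.
  apply/ler_addgt0Pr => e e0.
  have t1 : 1 < 1 + e / 3 by rewrite ltrDl divr_gt0.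
  have t0 : 0 < 1 + e / 3 by exact: lt_trans t1.
  apply: le_trans (dBM_le (ltW t0) (ler0n R n) dXn (embX _ t1)) _.
  have -> : 3 + e = (1 + e / 3) * 3 by field.
  by rewrite ler_wpM2l ?ler_nat// ltW.
apply/le_anti/andP; split.
  apply/ler_addgt0Pr => e e0.
  have b0 : 0 < dBM X (linf R n) + e by rewrite ltr_wpDl ?dBM_ge0.
  have emb : embeds X (linf R n) 1 (dBM X (linf R n) + e).
    apply: dBM_embeds dXn (embX 2 _) _ _ _; rewrite ?ltr1n//.
    by rewrite mul1r ltrDl.
  rewrite -[leRHS]mul1r; apply: dBM_le => //; first exact: ltW.
  apply: sumoo_embeds (emb); rewrite -[leRHS]mul1r.
  by apply: embeds_ge1 emb; rewrite ?dX// ltW.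
rewrite leNgt; apply/negP => lt.
pose c := (dBM (sumoo X (linf R m)) (linf R (n + m)) + dBM X (linf R n)) / 2.
have Ec : dBM (sumoo X (linf R m)) (linf R (n + m)) < c by rewrite /c; lra.
have cX : c < dBM X (linf R n) by rewrite /c; lra.
have c0 : 0 < c by exact: le_lt_trans (dBM_ge0 _ _) Ec.
suff : dBM X (linf R n) <= c by rewrite leNgt cX.
rewrite -[leRHS]mul1r; apply: dBM_le => //; first exact: ltW.
apply: (@sumoo_embeds_inv _ _ _ m); first by rewrite ltW// (lt_le_trans cX).
by apply: dBM_embeds dE (embE 2 _) _ _ _; rewrite ?ltr1n// mul1r.
Qed.
End Main.

Theorem corollary1p3 (R : realType) (n m : nat) (X : finNormedModType R) :
  (1 <= n)%N -> (1 <= m)%N -> \dim (fullv : {vspace X}) = n -> (n <= 3)%N ->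
  dBM (sum1 X (l1 R m)) (l1 R (n + m)) = dBM X (l1 R n) /\
  dBM (sumoo X (linf R m)) (linf R (n + m)) = dBM X (linf R n).
Proof.
by move=> n0 _ dX n3; split; [exact: dBM_sum1 | exact: dBM_sumoo].
Qed.
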